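(* Let $l\ge 1$ and let $\mathcal{C}_1,\dots,\mathcal{C}_l\subset U(n)$ be conjugacy classes of unitary matrices such that there exist $(u_1,\dots,u_l)\in\mathcal{C}_1\times\cdots\times\mathcal{C}_l$ with $u_1u_2\cdots u_l=1$. For such a $(u_1,\dots,u_l)$, the corresponding representation of $\pi_1(S^2\setminus\{s_1,\dots,s_l\})$ is $\sigma_0$-Lagrangian if and only if $$u_l=u_l^t,\qquad u_{l-1}=\overline{u}_l^{-1}u_{l-1}^t\overline{u}_l,\qquad\dots,\qquad u_1=\overline{u}_l^{-1}\overline{u}_{l-1}^{-1}\cdots\overline{u}_2^{-1}\,u_1^t\,\overline{u}_2\cdots\overline{u}_{l-1}\overline{u}_l,$$ that is, if and only if for every $j\in\{1,\dots,l\}$ one has $u_j=\overline{u}_l^{-1}\cdots\overline{u}_{j+1}^{-1}\,u_j^t\,\overline{u}_{j+1}\cdots\overline{u}_l$.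
   Context: $\pi_1(S^2\setminus\{s_1,\dots,s_l\})=\langle g_1,\dots,g_l\mid g_1g_2\cdots g_l=1\rangle$; a unitary representation of it is given by $u_1,\dots,u_l\in U(n)$ (the images of $g_1,\dots,g_l$) with $u_1\cdots u_l=1$. For a matrix $u$, $u^t$ is the transpose and $\overline{u}$ the entrywise complex conjugate. $\mathbb{C}^n$ carries the canonical Hermitian product $h=\sum_k dz_k\otimes d\overline{z}_k$ and the symplectic form $\omega=-\mathrm{Im}\,h$. A real subspace $L\subset\mathbb{C}^n$ is Lagrangian if $\omega|_{L\times L}=0$ and $\dim_{\mathbb{R}}L=n$; then $\mathbb{C}^n=L\oplus iL$. The Lagrangian involution associated to $L$ is the $\mathbb{R}$-linear map $\sigma_L:x+iy\mapsto x-iy$ ($x,y\in L$). A representation $(u_1,\dots,u_l)$ is called Lagrangian if there are Lagrangian subspaces $L_1,\dots,L_l$ of $\mathbb{C}^n$ such that, writing $\sigma_j=\sigma_{L_j}$ and $\sigma_{l+1}=\sigma_1$, one has $u_j=\sigma_j\sigma_{j+1}$ for all $j\in\{1,\dots,l\}$. It is called $\sigma_0$-Lagrangian if this is possible with $L_1=L_0:=\mathbb{R}^n\subset\mathbb{C}^n$. *)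

(* Defs.v *)
(* MathComp; the complex field is R[i] for R : realType, and matrices act on
   columns. A representation of pi_1 of the (l+1)-punctured sphere is the
   family u : 'I_l.+1 -> 'M[R[i]]_n of the images of the generators. *)
From HB Require Import structures.
From mathcomp Require Import all_boot all_order all_algebra.
From mathcomp Require Import ring complex classical_sets reals.

Set Implicit Arguments.
Unset Strict Implicit.
Unset Printing Implicit Defensive.

Import Order.TTheory GRing.Theory Num.Theory.
Local Open Scope ring_scope.
Local Open Scope complex_scope.

(* Column vectors of R[i] seen as a REAL vector space: the alias keeps the
   R-structure below apart from the canonical R[i]-structure on 'cV[R[i]]_n.
   With it, {vspace realC R n} is the type of real subspaces of C^n and \dim
   is the real dimension. *)
Definition realC (R : realType) (n : nat) : Type := 'cV[R[i]]_n.

HB.instance Definition _ (R : realType) (n : nat) :=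
  GRing.Zmodule.copy (realC R n) 'cV[R[i]]_n.

Section RealC.
Variables (R : realType) (n : nat).
Local Notation V := (realC R n).

Definition realC_scale (a : R) (z : V) : V := a%:C *: (z : 'cV[R[i]]_n).

Fact realC_scaleA a b z :
  realC_scale a (realC_scale b z) = realC_scale (a * b) z.
Proof. by rewrite /realC_scale scalerA -rmorphM. Qed.

Fact realC_scale1 : left_id 1 realC_scale.
Proof. by move=> z; rewrite /realC_scale rmorph1 scale1r. Qed.

Fact realC_scaleDr : right_distributive realC_scale +%R.
Proof. by move=> a z w; exact: scalerDr. Qed.

Fact realC_scaleDl z : {morph realC_scale^~ z : a b / a + b}.
Proof. by move=> a b; rewrite /realC_scale rmorphD; exact: scalerDl. Qed.

HB.instance Definition _ :=
  @GRing.Zmodule_isLmodule.Build R V realC_scale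
    realC_scaleA realC_scale1 realC_scaleDr realC_scaleDl.

Lemma realC_scaleE (a : R) (z : V) : a *: z = a%:C *: (z : 'cV[R[i]]_n).
Proof. by []. Qed.

Fact realC_vect_axiom : Vector.axiom (n + n) V.
Proof.
pose f (z : V) : 'rV[R]_(n + n) :=
  row_mx (\row_k complex.Re (z k 0)) (\row_k complex.Im (z k 0)).
pose g (r : 'rV[R]_(n + n)) : V :=
  \col_k (lsubmx r 0 k +i* rsubmx r 0 k).
exists f.
  move=> a z w; rewrite /f scale_row_mx add_row_mx.
  by congr row_mx; apply/rowP => k; rewrite realC_scaleE !mxE;
    case: (z k 0) => x y; case: (w k 0) => x' y' /=; rewrite mul0r ?subr0 ?addr0.
exists g => [z|r].
  by apply/colP => k; rewrite mxE row_mxKl row_mxKr !mxE; case: (z k 0).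
rewrite -[RHS]hsubmxK /f; congr row_mx; apply/rowP => k; by rewrite !mxE.
Qed.

HB.instance Definition _ := Lmodule_hasFinDim.Build R V realC_vect_axiom.

Definition hermitian (z w : V) : R[i] := \sum_(k < n) z k 0 * (w k 0)^*.

Definition omega (z w : V) : R := - complex.Im (hermitian z w).

Definition muli (z : V) : V := 'i *: (z : 'cV[R[i]]_n).

Fact muli_linear : linear muli.
Proof.
by move=> a z w; rewrite /muli !realC_scaleE [LHS]scalerDr !scalerA mulrC.
Qed.
HB.instance Definition _ := GRing.isLinear.Build R V V *:%R muli muli_linear.

Definition lagrangian (L : {vspace V}) : Prop :=
  (forall z w, z \in L -> w \in L -> omega z w = 0) /\ \dim L = n.

Definition iL (L : {vspace V}) : {vspace V} := (linfun muli @: L)%VS.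

(* The map x + iy |-> x - iy (x, y in L), written with the projections of
   L (+) iL; [lagr_involE] shows that it is this map when L is Lagrangian. *)
Definition lagr_invol (L : {vspace V}) : 'End(V) :=
  (daddv_pi L (iL L) - daddv_pi (iL L) L)%R.

Lemma muliK (z : V) : muli (muli z) = - z.
Proof.
by apply/colP => k; rewrite !mxE; case: (z k 0) => x y; simpc.
Qed.

Lemma muli_inj : injective muli.
Proof.
by move=> z w /(congr1 muli); rewrite !muliK => /oppr_inj.
Qed.

Lemma memv_iL (L : {vspace V}) (y : V) : y \in L -> muli y \in iL L.
Proof. by move=> yL; have := memv_img (linfun muli) yL; rewrite lfunE. Qed.

Lemma omega_muli_eq0 (z : V) : omega (muli z) z = 0 -> z = 0.
Proof.
rewrite /omega /hermitian (raddf_sum (@complex.Im R)) => /eqP.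
rewrite oppr_eq0 (eq_bigr (fun k : 'I_n =>
  complex.Re (z k 0) ^+ 2 + complex.Im (z k 0) ^+ 2)); last first.
  by move=> k _; rewrite mxE; case: (z k 0) => x y /=; ring.
rewrite psumr_eq0; last by move=> k _; rewrite addr_ge0 ?sqr_ge0.
move=> /allP h; apply/colP => k; rewrite mxE.
have := h k (mem_index_enum k); rewrite paddr_eq0 ?sqr_ge0 // !sqrf_eq0 /=.
by case: (z k 0) => x y /= /andP[/eqP -> /eqP ->].
Qed.

Lemma lagr_capv L : lagrangian L -> (L :&: iL L = 0)%VS.
Proof.
case=> om _; apply/eqP; rewrite -subv0; apply/subvP => z.
rewrite memv_cap => /andP[zL /memv_imgP[y yL]]; rewrite lfunE /= => zE.
by rewrite memv0 zE (omega_muli_eq0 (z := y)) ?linear0 ?eqxx // -zE; exact: om.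
Qed.

Lemma lagr_addv L : lagrangian L -> (L + iL L = fullv)%VS.
Proof.
move=> hL; apply/eqP; rewrite eqEdim subvf dimv_disjoint_sum ?lagr_capv //.
rewrite /iL limg_dim_eq.
  by case: hL => _ ->; rewrite dimvf leqnn.
apply/eqP; rewrite -subv0; apply/subvP => z; rewrite memv_cap memv_ker lfunE.
case/andP=> _ /eqP /= h; rewrite memv0; apply/eqP/muli_inj.
by rewrite h linear0.
Qed.

Lemma lagr_involE (L : {vspace V}) (x y : V) :
  lagrangian L -> x \in L -> y \in L ->
  lagr_invol L (x + muli y) = x - muli y.
Proof.
move=> hL xL yL; have cap := lagr_capv hL; have yi := memv_iL yL.
have pi0 (A B : {vspace V}) w :
    (A :&: B = 0)%VS -> w \in B -> daddv_pi A B w = 0.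
  move=> AB wB; have BA : (B :&: A = 0)%VS by rewrite capvC.
  have := daddv_pi_add AB (subvP (addvSr A B) _ wB).
  by rewrite (daddv_pi_id BA wB) => /(canRL (addrK _)); rewrite subrr.
have cap' : (iL L :&: L = 0)%VS by rewrite capvC.
rewrite /lagr_invol add_lfunE opp_lfunE !linearD /=.
rewrite (daddv_pi_id cap xL) (daddv_pi_id cap' yi) !pi0 //.
by rewrite ?(oppr0, addr0, add0r).
Qed.

Definition real_vec (x : 'cV[R]_n) : V := map_mx (real_complex R) x.

Fact real_vec_linear : linear real_vec.
Proof. by move=> a x y; rewrite /real_vec map_mxD map_mxZ. Qed.
HB.instance Definition _ :=
  GRing.isLinear.Build R 'cV[R]_n V *:%R real_vec real_vec_linear.

Definition L0 : {vspace V} := limg (linfun real_vec).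

Lemma L0_lagrangian : lagrangian L0.
Proof.
split.
  move=> z w /memv_imgP[x _ ->] /memv_imgP[y _ ->]; rewrite !lfunE /=.
  rewrite /omega /hermitian (raddf_sum (@complex.Im R)) big1 ?oppr0 // => k _.
  by rewrite !mxE /=; simpc; rewrite /= ?oppr0 ?mulr0 ?mul0r ?addr0.
rewrite /L0 limg_dim_eq ?dimvf /dim /= ?muln1 //.
apply/eqP; rewrite -subv0; apply/subvP => x; rewrite memv_cap memv_ker lfunE.
case/andP=> _ /eqP /= h; rewrite memv0; apply/eqP/colP => k.
by have /colP/(_ k) := h; rewrite !mxE => -[].
Qed.

Definition conjmat (A : 'M[R[i]]_n) : 'M[R[i]]_n := map_mx (@conjc R) A.

Definition unitary_class (C : set 'M[R[i]]_n) : Prop :=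
  exists2 a : 'M[R[i]]_n, a \is unitarymx &
    C = [set b | exists2 w, w \is unitarymx & b = w *m a *m invmx w]%classic.

(* u_j = sigma_j sigma_(j+1), with indices cyclic ([ordS]). *)
Definition lagrangian_family l (u : 'I_l -> 'M[R[i]]_n)
    (L : 'I_l -> {vspace V}) : Prop :=
  (forall j, lagrangian (L j)) /\
  forall j (z : V), u j *m z = lagr_invol (L j) (lagr_invol (L (ordS j)) z).

Definition lagrangian_rep l (u : 'I_l -> 'M[R[i]]_n) : Prop :=
  exists L, lagrangian_family u L.

Definition sigma0_lagrangian_rep l (u : 'I_l.+1 -> 'M[R[i]]_n) : Prop :=
  exists2 L, lagrangian_family u L & L ord0 = L0.

End RealC.

(* Main.v *)
(* Put T_j = u_j u_(j+1) ... u_l and let c be complex conjugation, so that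
   c = sigma_(L_1) when L_1 = L_0. If u_k = sigma_k sigma_(k+1) for all k, the
   product telescopes to T_j = sigma_j c, i.e. sigma_j = T_j c; as sigma_j is an
   involution, T_j conj(T_j) = 1, which for the unitary T_j means that T_j is
   symmetric. Conversely, if T_j is unitary and symmetric, then T_j c is an
   anti-unitary involution, hence the Lagrangian involution of its fixed space,
   and u_j = T_j T_(j+1)^-1 = (T_j c) (T_(j+1) c). Finally the condition on u_j
   reads u_j = T_j^t conj(T_(j+1)), so by descending induction on j these
   conditions say that all the T_j are symmetric. *)
From HB Require Import structures.
Require Import Defs.
From mathcomp Require Import all_boot all_order all_algebra.
From mathcomp Require Import complex classical_sets reals.

Set Implicit Arguments.
Unset Strict Implicit.
Unset Printing Implicit Defensive.

Import GRing.Theory Num.Theory.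
Local Open Scope ring_scope.
Local Open Scope complex_scope.

(** * Ordered products of matrices and cyclic indices *)

HB.instance Definition _ (R : pzSemiRingType) (n : nat) :=
  Monoid.isLaw.Build 'M[R]_n 1%:M mulmx
    (@mulmxA R n n n n) (@mul1mx R n n) (@mulmx1 R n n).

Lemma big_ord_recl_geq (T : Type) (idx : T) (op : Monoid.law idx) (n : nat)
    (F : 'I_n.+1 -> T) (j : 'I_n.+1) :
  \big[op/idx]_(k < n.+1 | (j <= k)%N) F k =
  op (F j) (\big[op/idx]_(k < n.+1 | (j < k)%N) F k).
Proof.
pose G k := F (inord k).
have bigG (m : nat) : \big[op/idx]_(k < n.+1 | (m <= k)%N) F k =
    \big[op/idx]_(m <= k < n.+1) G k.
  rewrite big_geq_mkord; apply: eq_bigr => k _.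
  by rewrite /G inord_val.
by rewrite !bigG big_ltn // {1}/G inord_val.
Qed.

(** Descending induction along the cycle: [ordS] sends the last index to [ord0], so [Q ord0] starts
    the descent at the top. *)
Lemma ordS_ind (n : nat) (Q : 'I_n.+1 -> Prop) :
  Q ord0 -> (forall j, Q (ordS j) -> Q j) -> forall j, Q j.
Proof.
move=> Q0 QS j; rewrite -[j]rev_ordK; move: (rev_ord j) => {j} [m].
elim: m => [|m IH] lt_m; apply: QS.
  by congr Q: Q0; apply/val_inj; rewrite /= subn1 modnn.
congr Q: (IH (ltnW lt_m)); apply/val_inj => /=.
by rewrite subnSK // subSS modn_small // ltnS leq_subr.
Qed.

Lemma big_mulmx_unitary (K : numClosedFieldType) (I : Type) (r : seq I)
    (P : pred I) n (F : I -> 'M[K]_n) :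
  (forall i, F i \is unitarymx) ->
  \big[mulmx/1%:M]_(i <- r | P i) F i \is unitarymx.
Proof.
move=> hF; apply: (big_ind (fun M : 'M[K]_n => M \is unitarymx)) => //.
  by apply/unitarymxP; rewrite trmx1 map_mx1 mulmx1.
by move=> A B; exact: mul_unitarymx.
Qed.

Lemma trmx_big_mulmx (K : comNzRingType) (I : Type) (r : seq I)
    (P : pred I) n (F : I -> 'M[K]_n) :
  (\big[mulmx/1%:M]_(i <- r | P i) F i)^T =
  \big[mulmx/1%:M]_(i <- rev r | P i) (F i)^T.
Proof.
elim: r => [|i r IHr]; first by rewrite !big_nil trmx1.
rewrite rev_cons big_rcons /= big_cons; case: (P i); last by rewrite mulmx1.
by rewrite trmx_mul IHr.
Qed.

(** * Complex conjugation, unitary matrices and Lagrangian involutions *)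

Section Conjugation.
Variables (R : realType) (n : nat).
Local Notation V := (realC R n).
Implicit Types (M P : 'M[R[i]]_n) (z w : V).

Definition conjv z : V := map_mx (@conjc R) z.

Lemma conjvK : involutive conjv.
Proof. by move=> z; apply/colP => k; rewrite !mxE conjcK. Qed.

Lemma conjv_mulmx M z : conjv (M *m z) = conjmat M *m conjv z.
Proof. exact: map_mxM. Qed.

Lemma conjmat_big_mulmx (I : Type) (r : seq I) (Q : pred I)
    (F : I -> 'M[R[i]]_n) :
  \big[mulmx/1%:M]_(i <- r | Q i) conjmat (F i) =
  conjmat (\big[mulmx/1%:M]_(i <- r | Q i) F i).
Proof.
rewrite (big_morph (@conjmat R n) (id1 := 1%:M) (op1 := mulmx)) //.
  exact: map_mxM.
exact: map_mx1.
Qed.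

Lemma mulmx_conj_tr M : M \is unitarymx -> M *m (conjmat M)^T = 1%:M.
Proof. by move=> /unitarymxP; rewrite /conjmat map_trmx. Qed.

Lemma mul_tr_conjmx M : M \is unitarymx -> M^T *m conjmat M = 1%:M.
Proof.
by rewrite -trmx_unitary => /mulmx_conj_tr; rewrite /conjmat map_trmx trmxK.
Qed.

Lemma invmx_conj M : M \is unitarymx -> invmx (conjmat M) = M^T.
Proof.
move=> hM; have h := mul_tr_conjmx hM; have [_ cu] := mulmx1_unit h.
by rewrite -[RHS](mulmxK cu) h mul1mx.
Qed.

(** Unitarity says that [M^T] is the inverse of [conjmat M], and inverses are unique. *)
Lemma unitary_sym M :
  M \is unitarymx -> M *m conjmat M = 1%:M <-> M^T = M.
Proof.
move=> hM; split=> [h|hT]; last by rewrite -{1}hT mul_tr_conjmx.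
have [_ cu] := mulmx1_unit h.
by apply: (can_inj (mulmxK cu)); rewrite h mul_tr_conjmx.
Qed.

Lemma unitary_class_unitary (C : set 'M[R[i]]_n) M :
  unitary_class C -> C M -> M \is unitarymx.
Proof.
case=> a ha -> [w hw ->]; rewrite invmx_unitary //.
by rewrite !mul_unitarymx ?trmxC_unitary.
Qed.

Lemma lagrangian_decomp (L : {vspace V}) z : lagrangian L ->
  exists x y, [/\ x \in L, y \in L & z = x + muli y].
Proof.
move=> hL; have := memvf z; rewrite -(lagr_addv hL).
case/memv_addP=> x xL [_ /memv_imgP[y yL ->] ->].
by exists x, y; rewrite lfunE.
Qed.

Lemma lagr_involK (L : {vspace V}) : lagrangian L -> involutive (lagr_invol L).
Proof.
move=> hL z; have [x [y [xL yL ->]]] := lagrangian_decomp z hL.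
by rewrite lagr_involE // -linearN lagr_involE ?rpredN // linearN opprK.
Qed.

Lemma memv_L0 z : (z \in L0 R n) = (conjv z == z).
Proof.
apply/memv_imgP/eqP => [[x _ ->]|hz].
  by rewrite lfunE; apply/colP => k; rewrite !mxE conjc_real.
exists (\col_k complex.Re (z k 0)); rewrite ?memvf // lfunE /=.
apply/colP => k; rewrite !mxE; have /colP/(_ k) := hz; rewrite mxE.
case: (z k 0) => x y /= [] /eqP; rewrite eq_sym -addr_eq0 -mulr2n.
by rewrite mulrn_eq0 /= => /eqP->.
Qed.

(** With [P] equal to T_j this is the candidate for sigma_j. *)
Definition anticonj P z : V := P *m conjv z.

Fact anticonj_linear P : linear (anticonj P).
Proof.
move=> a z w; rewrite /anticonj !realC_scaleE -[in RHS](conjc_real a).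
by rewrite scalemxAr -[RHS]mulmxDr /conjv map_mxD map_mxZ.
Qed.
HB.instance Definition _ P :=
  GRing.isLinear.Build R V V *:%R (anticonj P) (anticonj_linear P).

Lemma anticonj_muli P z : anticonj P (muli z) = - muli (anticonj P z).
Proof.
have conji : - 'i = conjc 'i :> R[i] by simpc.
by rewrite /anticonj /muli -[RHS]scaleNr conji scalemxAr /conjv map_mxZ.
Qed.

Lemma anticonjK P : P *m conjmat P = 1%:M -> involutive (anticonj P).
Proof.
by move=> hP z; rewrite /anticonj conjv_mulmx conjvK mulmxA hP mul1mx.
Qed.

(** An antilinear map that fixes [L] pointwise acts as -1 on [iL L], and these two spaces span. *)
Lemma lagr_invol_eq (L : {vspace V}) P z : lagrangian L ->
  (forall x, x \in L -> anticonj P x = x) -> lagr_invol L z = anticonj P z.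
Proof.
move=> hL fixL; have [x [y [xL yL ->]]] := lagrangian_decomp z hL.
by rewrite lagr_involE // linearD /= anticonj_muli !fixL.
Qed.

Lemma lagr_invol_L0 z : lagr_invol (L0 R n) z = conjv z.
Proof.
rewrite (@lagr_invol_eq _ 1%:M) /anticonj ?mul1mx //.
  exact: L0_lagrangian.
by move=> x; rewrite memv_L0 mul1mx => /eqP.
Qed.

Lemma hermitianE z w : Defs.hermitian z w = (z^T *m conjv w) 0 0.
Proof. by rewrite mxE; apply: eq_bigr => k _; rewrite !mxE. Qed.

Lemma hermitian_anticonj P z w : P \is unitarymx ->
  Defs.hermitian (anticonj P z) (anticonj P w) = (Defs.hermitian z w)^*.
Proof.
move=> hP; rewrite hermitianE /anticonj trmx_mul conjv_mulmx mulmxA.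
rewrite -(mulmxA _ P^T) mul_tr_conjmx // mulmx1 conjvK.
rewrite /Defs.hermitian rmorph_sum mxE; apply: eq_bigr => k _.
by rewrite !mxE rmorphM /= conjcK.
Qed.

Definition fixedL P : {vspace V} := fixedSpace (linfun (anticonj P)).

Lemma memv_fixedL P z : (z \in fixedL P) = (anticonj P z == z).
Proof. by apply/fixedSpaceP/eqP; rewrite lfunE. Qed.

Lemma fixedL_lagrangian P :
  P \is unitarymx -> P *m conjmat P = 1%:M -> lagrangian (fixedL P).
Proof.
move=> hP hK; have om z w : z \in fixedL P -> w \in fixedL P -> omega z w = 0.
  rewrite !memv_fixedL => /eqP hz /eqP hw.
  (* For fixed vectors the Hermitian product equals its own conjugate, so it is real. *)
  have := hermitian_anticonj z w hP; rewrite hz hw /omega.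
  case: (Defs.hermitian z w) => a b [] /eqP; rewrite -addr_eq0 -mulr2n.
  by rewrite mulrn_eq0 /= => /eqP->; rewrite oppr0.
split=> //; set L := fixedL P.
have cap : (L :&: iL L = 0)%VS.
  apply/eqP; rewrite -subv0; apply/subvP => z.
  rewrite memv_cap => /andP[zL /memv_imgP[y yL]]; rewrite lfunE /= => zE.
  by rewrite memv0 zE (omega_muli_eq0 (z := y)) ?linear0 ?eqxx // -zE om.
have dimi : \dim (iL L) = \dim L.
  apply: limg_dim_eq; apply/eqP; rewrite -subv0; apply/subvP => z.
  rewrite memv_cap memv_ker lfunE => /andP[_ /eqP /= h].
  by rewrite memv0; apply/eqP/muli_inj; rewrite h linear0.
have full : (L + iL L = fullv)%VS.
  apply/eqP; rewrite eqEsubv subvf; apply/subvP => z _.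
  have AK := anticonjK hK.
  have two : (2%:R : R) != 0 by rewrite pnatr_eq0.
  (* Splitting into the +1 and -1 eigenspaces of the involution; by antilinearity the latter is
     [iL L]. *)
  pose x := 2%:R^-1 *: (z + anticonj P z).
  pose y := 2%:R^-1 *: (z - anticonj P z).
  have Ay : anticonj P y = - y.
    by rewrite linearZ linearB /= AK -opprB scalerN.
  apply/memv_addP; exists x.
    by rewrite memv_fixedL linearZ linearD /= AK addrC.
  exists y.
    rewrite -[y]opprK -muliK memv_iL // memv_fixedL anticonj_muli.
    by rewrite (linearN (anticonj P)) /= Ay !(linearN (@muli R n)) opprK.
  rewrite -scalerDr addrACA subrr addr0 -mulr2n.
  by rewrite -scaler_nat scalerA mulVf ?scale1r.
(* Comparing dimensions, 2n is twice the dimension of [L]. *)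
have := dimv_disjoint_sum cap; rewrite full dimi dimvf /dim /= => /eqP.
by rewrite !addnn (inj_eq double_inj) => /eqP.
Qed.

Lemma lagr_invol_fixedL P z : P \is unitarymx -> P *m conjmat P = 1%:M ->
  lagr_invol (fixedL P) z = anticonj P z.
Proof.
move=> hP hK; apply: lagr_invol_eq; first exact: fixedL_lagrangian.
by move=> x; rewrite memv_fixedL => /eqP.
Qed.

Lemma fixedL1 : fixedL 1%:M = L0 R n.
Proof.
by apply/vspaceP => z; rewrite memv_fixedL memv_L0 /anticonj mul1mx.
Qed.

End Conjugation.

(** * Lagrangian families and symmetry of the tail products *)

Theorem theorem1 (R : realType) (n l : nat)
    (C : 'I_l.+1 -> set 'M[R[i]]_n)
    (hC : forall j, unitary_class (C j))
    (hne : exists v : 'I_l.+1 -> 'M[R[i]]_n,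
       (forall j, C j (v j)) /\ \big[mulmx/1%:M]_(j < l.+1) v j = 1%:M)
    (u : 'I_l.+1 -> 'M[R[i]]_n)
    (hu : forall j, C j (u j))
    (hprod : \big[mulmx/1%:M]_(j < l.+1) u j = 1%:M) :
  sigma0_lagrangian_rep u <->
  forall j : 'I_l.+1,
    u j = (\big[mulmx/1%:M]_(k <- rev (enum 'I_l.+1) | (j < k)%N)
             invmx (conjmat (u k)))
          *m (u j)^T
          *m (\big[mulmx/1%:M]_(k < l.+1 | (j < k)%N) conjmat (u k)).
Proof.
have uU k : u k \is unitarymx by apply: unitary_class_unitary (hu k).
pose T (j : nat) := \big[mulmx/1%:M]_(k < l.+1 | (j <= k)%N) u k.
have TU j : T j \is unitarymx by apply: big_mulmx_unitary.
have T0 : T 0 = 1%:M by rewrite -[RHS]hprod; apply: eq_bigl.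
(* At the last index [ordS] wraps to 0; there [T 0] is 1 by [hprod], which agrees with the empty
   product [T l.+1]. *)
have T_ordS (j : 'I_l.+1) : T (ordS j) = T j.+1.
  rewrite /=; have := ltn_ord j.
  rewrite leq_eqVlt => /orP[/eqP->|/modn_small->//].
  by rewrite modnn T0 /T big_pred0 // => k; rewrite leqNgt ltn_ord.
have T_rec (j : 'I_l.+1) : T j = u j *m T (ordS j).
  by rewrite T_ordS; exact: big_ord_recl_geq.
(* The inverse of each [conjmat (u k)] is [(u k)^T], and transposition reverses products, so the
   reversed product is the transpose of T_(j+1). *)
have condE (j : 'I_l.+1) :
    (\big[mulmx/1%:M]_(k <- rev (enum 'I_l.+1) | (j < k)%N)
       invmx (conjmat (u k)))
    *m (u j)^T
    *m (\big[mulmx/1%:M]_(k < l.+1 | (j < k)%N) conjmat (u k)) =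
    (T j)^T *m conjmat (T (ordS j)).
  rewrite conjmat_big_mulmx T_rec T_ordS trmx_mul; congr (_ *m _ *m _).
  rewrite /T trmx_big_mulmx /index_enum /= enumT; apply: eq_bigr => k _.
  exact: invmx_conj.
suff -> : sigma0_lagrangian_rep u <-> forall j : 'I_l.+1, (T j)^T = T j.
  split=> [sym j|cond].
    by rewrite condE sym T_rec -mulmxA (unitary_sym (TU _)).2 ?mulmx1.
  apply: ordS_ind => [|j sym]; first by rewrite T0 trmx1.
  rewrite [RHS]T_rec cond condE -mulmxA.
  by rewrite (mulmx1C ((unitary_sym (TU _)).2 sym)) mulmx1.
split=> [[L [hL Lu] L00]|sym]; last first.
  have invT (j : 'I_l.+1) := (unitary_sym (TU j)).2 (sym j).
  (* At j = 0 the matrix is 1, whose fixed space is the required [L0]. *)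
  exists (fun j : 'I_l.+1 => fixedL (T j)); last by rewrite T0 fixedL1.
  split=> [j|j z]; first exact: fixedL_lagrangian.
  rewrite !lagr_invol_fixedL // T_rec /anticonj conjv_mulmx conjvK.
  by rewrite -!mulmxA (mulmxA (T _)) invT mul1mx.
(* Telescoping: T_j c = u_j sigma_(j+1) = sigma_j, starting from sigma_(L_0) = c. *)
have TL : forall (j : 'I_l.+1) (z : realC R n),
    T j *m conjv z = lagr_invol (L j) z.
  apply: ordS_ind => [z|j IH z]; first by rewrite T0 mul1mx L00 lagr_invol_L0.
  by rewrite T_rec -mulmxA IH Lu lagr_involK.
move=> j; apply/unitary_sym => //; apply/matrixP => i k.
(* Evaluating sigma_j^2 = 1 at the k-th basis vector gives the k-th column of T_j conj(T_j) = 1. *)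
have := lagr_involK (hL j) (delta_mx k 0 : 'cV[R[i]]_n).
rewrite -!TL conjv_mulmx conjvK mulmxA -colE => /colP/(_ i).
by rewrite !mxE eqxx andbT.
Qed.
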